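(* Let $\Sigma=(\mathbb{R}^n,\mathsf{U},\mathcal{U}_\tau,f,\sigma)$ be a stochastic control system with $\mathsf{U}$ a finite union of boxes and input curves in $\mathcal{U}_\tau$, and let $\mathsf{q}=(\tau,\eta,\mu)$ be a triple of quantization parameters. For any $\epsilon\in\mathbb{R}^+$ and $\widehat\varepsilon\in[0,1]$, if $S_\tau(\Sigma)\cong^{\varepsilon}_{\mathcal{S}}S_{\mathsf{q}}(\Sigma)$ for $\varepsilon=\epsilon\widehat\varepsilon$, then $S_\tau(\Sigma)\cong^{(\epsilon,\widehat\varepsilon)}_{\mathcal{S}}S_{\mathsf{q}}(\Sigma)$.
   Context: Notation. $\|\cdot\|$ is the infinity norm on vectors and the induced infinity norm on matrices; $\mathbb{R}^+=(0,\infty)$, $\mathbb{R}_0^+=[0,\infty)$. Stochastic control system. Fix a probability space $(\Omega,\mathcal{F},\mathbb{P})$ with a filtration $(\mathcal{F}_s)_{s\ge0}$ satisfying the usual conditions and a $p$-dimensional Brownian motion $(W_s)$ with respect to it. A stochastic control system is a tuple $\Sigma=(\mathbb{R}^n,\mathsf{U},\mathcal{U},f,\sigma)$ with $\mathsf{U}\subseteq\mathbb{R}^m$; $\mathcal{U}$ a subset of the measurable, locally essentially bounded functions $[0,\infty)\to\mathsf{U}$; $f:\mathbb{R}^n\times\mathsf{U}\to\mathbb{R}^n$ continuous with $\|f(x,u)-f(x',u')\|\le L_x\|x-x'\|+L_u\|u-u'\|$ for constants $L_x,L_u>0$; $\sigma:\mathbb{R}^n\to\mathbb{R}^{n\times p}$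 continuous with $\|\sigma(x)-\sigma(x')\|\le Z\|x-x'\|$ for a constant $Z>0$. Solution processes are solutions of $d\xi=f(\xi,\upsilon)dt+\sigma(\xi)dW_t$. $\mathcal{U}_\tau$ is the set of $\upsilon:\mathbb{R}_0^+\to\mathsf{U}$ that are constant on each $[(k-1)\tau,k\tau)$, $k\in\mathbb{N}$. Quantization. A box is $B=\prod_{i}[c_i,d_i]$ with $c_i<d_i$; $[B]_\mu=\{b\in B: b_i=k_i\mu,\ k_i\in\mathbb{Z}\}$. For a finite union $A=\bigcup_jA_j$ of boxes, $[A]_\mu=\bigcup_j[A_j]_\mu$. $[\mathbb{R}^n]_\eta=\{a\in\mathbb{R}^n:a_i=k_i\eta,\ k_i\in\mathbb{Z}\}$. Systems. A system is $S=(X,X_0,U,\to,Y,H)$: states $X$, initial states $X_0\subseteq X$, inputs $U$, transitions $\to\subseteq X\times U\times X$ (written $x\xrightarrow{u}x'$), outputs $Y$, output map $H:X\to Y$. $S_\tau(\Sigma)=(X_\tau,X_{\tau0},U_\tau,\to_\tau,Y_\tau,H_\tau)$: $X_\tau=Y_\tau$ is the set of $\mathbb{R}^n$-valued random variables on $(\Omega,\mathcal{F},\mathbb{P})$; $X_{\tau0}$ is the set of deterministic (constant) ones; $U_\tau=\mathcal{U}_\tau$; $H_\tau$ is the identity; $x_\tau\xrightarrow{\upsilon_\tau}_\tau x_\tau'$ iff for some $k\in\mathbb{N}_0$, $x_\tau$ is $\mathcal{F}_{k\tau}$-measurable, $x'_\tau$ is $\mathcal{F}_{(k+1)\tau}$-measurable,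 and the solution process of $\Sigma$ started at time $k\tau$ from $x_\tau$ under input $\upsilon_\tau$ equals $x_\tau'$ a.s. after a duration $\tau$. $S_{\mathsf{q}}(\Sigma)=(X_{\mathsf{q}},X_{\mathsf{q}0},U_{\mathsf{q}},\to_{\mathsf{q}},Y_{\mathsf{q}},H_{\mathsf{q}})$: $X_{\mathsf{q}}=X_{\mathsf{q}0}=[\mathbb{R}^n]_\eta$; $U_{\mathsf{q}}=[\mathsf{U}]_\mu$; $x_{\mathsf{q}}\xrightarrow{u_{\mathsf{q}}}_{\mathsf{q}}x'_{\mathsf{q}}$ iff $\|\overline\xi_{x_{\mathsf{q}}u_{\mathsf{q}}}(\tau)-x'_{\mathsf{q}}\|\le\eta$, with $\overline\xi$ the solution of the ODE $\dot{\overline\xi}=f(\overline\xi,u_{\mathsf{q}})$ from $x_{\mathsf{q}}$ under the constant input $u_{\mathsf{q}}$; $Y_{\mathsf{q}}=Y_\tau$; $H_{\mathsf{q}}$ sends a grid point to the corresponding constant random variable. Outputs carry the metric $\mathbf{d}(y,y')=(\mathbb{E}[\|y-y'\|^q])^{1/q}$ for some fixed $q\ge1$. $\varepsilon$-approximate bisimulation. For systems $S_a,S_b$ with the same output set and metric $\mathbf{d}$, $R\subseteq X_a\times X_b$ is an $\varepsilon$-approximate simulation relation from $S_a$ to $S_b$ if (i) every $x_{a0}\in X_{a0}$ has some $x_{b0}\in X_{b0}$ with $(x_{a0},x_{b0})\in R$; (ii) $(x_a,x_b)\in R$ implies $\mathbf{d}(H_a(x_a),H_b(x_b))\le\varepsilon$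 (when $\varepsilon=0$, this is replaced by: $(x_a,x_b)\in R$ iff $H_a(x_a)=H_b(x_b)$); (iii) for $(x_a,x_b)\in R$, every transition $x_a\xrightarrow{u_a}_ax_a'$ admits a transition $x_b\xrightarrow{u_b}_bx_b'$ with $(x_a',x_b')\in R$. $R$ is an $\varepsilon$-approximate bisimulation relation between $S_a$ and $S_b$ if also $R^{-1}$ is an $\varepsilon$-approximate simulation relation from $S_b$ to $S_a$; $S_a\cong^\varepsilon_{\mathcal{S}}S_b$ means that one exists. $(\epsilon,\widehat\varepsilon)$-approximate bisimulation. The notions of $(\epsilon,\widehat\varepsilon)$-approximate simulation relation, $(\epsilon,\widehat\varepsilon)$-approximate bisimulation relation, and $S_\tau(\Sigma)\cong^{(\epsilon,\widehat\varepsilon)}_{\mathcal{S}}S_{\mathsf{q}}(\Sigma)$ are defined in the same way between $S_\tau(\Sigma)$ and $S_{\mathsf{q}}(\Sigma)$, with conditions (i) and (iii) unchanged and condition (ii) replaced by: for every $(x_\tau,x_{\mathsf{q}})\in R$, $\mathbb{P}\{\|H_\tau(x_\tau)-H_{\mathsf{q}}(x_{\mathsf{q}})\|\ge\epsilon\}\le\widehat\varepsilon$. *)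

(* Defs.v *)
From HB Require Import structures.
From mathcomp Require Export all_boot all_order all_algebra.
From mathcomp Require Export all_classical all_reals all_analysis.

Set Implicit Arguments.
Unset Strict Implicit.
Unset Printing Implicit Defensive.

Import Order.TTheory GRing.Theory Num.Theory.
Export numFieldNormedType.Exports.

Local Open Scope classical_set_scope.
Local Open Scope ring_scope.

(* Vectors are columns ['cV[R]_n]; MathComp-Analysis's norm [`|x|] on matrices
   is the largest absolute value of an entry, i.e. the infinity norm on
   vectors.  For matrices the induced norm is [opnorm] below.  Functions of
   time are total functions on [R] that are only constrained on nonnegative
   times. *)

Definition opnorm (R : realType) (n p : nat) (A : 'M[R]_(n, p)) : R :=
  sup [set `|A *m v| | v in [set v : 'cV[R]_p | `|v| <= 1]].

Section Systems.
Variable R : realType.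

(* The metric may be infinite and [oeq] is the equality that it separates;
   for random vectors this is almost sure equality. *)
Record output_space := OutputSpace {
  ocarrier :> Type ;
  oeq : ocarrier -> ocarrier -> Prop ;
  odist : ocarrier -> ocarrier -> \bar R }.

Record system (Y : Type) := System {
  state : Type ;
  init : set state ;
  input : Type ;
  trans : state -> input -> state -> Prop ;
  out : state -> Y }.

Definition inverse_rel (A B : Type) (Rel : A -> B -> Prop) : B -> A -> Prop :=
  fun b a => Rel a b.

Definition init_condition (Y : Type) (Sa Sb : system Y)
    (Rel : state Sa -> state Sb -> Prop) : Prop :=
  forall xa, init xa -> exists2 xb, init xb & Rel xa xb.

Definition trans_condition (Y : Type) (Sa Sb : system Y)
    (Rel : state Sa -> state Sb -> Prop) : Prop :=
  forall xa xb, Rel xa xb -> forall ua xa', trans xa ua xa' ->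
    exists ub xb', trans xb ub xb' /\ Rel xa' xb'.

Definition approx_simulation (Y : output_space) (eps : R) (Sa Sb : system Y)
    (Rel : state Sa -> state Sb -> Prop) : Prop :=
  [/\ init_condition Rel,
      (if eps == 0
       then forall xa xb, Rel xa xb <-> oeq (out xa) (out xb)
       else forall xa xb, Rel xa xb -> (odist (out xa) (out xb) <= eps%:E)%E)
    & trans_condition Rel].

Definition approx_bisimulation (Y : output_space) (eps : R) (Sa Sb : system Y)
    (Rel : state Sa -> state Sb -> Prop) : Prop :=
  approx_simulation eps Rel /\ approx_simulation eps (inverse_rel Rel).

Definition approx_bisimilar (Y : output_space) (eps : R) (Sa Sb : system Y) :=
  exists Rel : state Sa -> state Sb -> Prop, approx_bisimulation eps Rel.

End Systems.

Section RandomVectors.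
Context (R : realType) (d : measure_display) (T : measurableType d).
Variables (P : probability T R) (n : nat).

Record random_vector := RandomVector {
  rv_fun :> T -> 'cV[R]_n ;
  rv_measurable : forall i, measurable_fun setT (fun w => rv_fun w i 0) }.

Lemma cst_measurable (c : 'cV[R]_n) (i : 'I_n) :
  measurable_fun setT (fun w : T => cst c w i 0).
Proof. exact: measurable_cst. Qed.

Definition cst_rv (c : 'cV[R]_n) : random_vector :=
  RandomVector (cst_measurable c).

Definition rv_dist (q : R) (y y' : random_vector) : \bar R :=
  ('E_P[fun w => (`|y w - y' w| `^ q)%R] `^ q^-1)%E.

Definition rv_space (q : R) : output_space R :=
  @OutputSpace R random_vector (fun y y' => \forall w \ae P, y w = y' w)
    (rv_dist q).

Definition prob_simulation (eps epshat : R) (Sa Sb : system random_vector)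
    (Rel : state Sa -> state Sb -> Prop) : Prop :=
  [/\ init_condition Rel,
      (forall xa xb, Rel xa xb ->
        (P [set w | (eps <= `|out xa w - out xb w|)%R] <= epshat%:E)%E)
    & trans_condition Rel].

Definition prob_bisimulation (eps epshat : R) (Sa Sb : system random_vector)
    (Rel : state Sa -> state Sb -> Prop) : Prop :=
  prob_simulation eps epshat Rel /\
  prob_simulation eps epshat (inverse_rel Rel).

Definition prob_bisimilar (eps epshat : R) (Sa Sb : system random_vector) :=
  exists Rel : state Sa -> state Sb -> Prop, prob_bisimulation eps epshat Rel.

End RandomVectors.

Section StochasticCalculus.
Context (R : realType) (d : measure_display) (T : measurableType d).
Variable P : probability T R.
Implicit Types (F : R -> set (set T)) (G : set (set T)).

Local Notation leb := (@lebesgue_measure R).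

Definition measurable_wrt G (X : T -> R) : Prop :=
  forall B : set R, measurable B -> G (X @^-1` B).

Definition vec_measurable_wrt (n : nat) G (X : T -> 'cV[R]_n) : Prop :=
  forall i, measurable_wrt G (fun w => X w i 0).

Record usual_filtration F : Prop := UsualFiltration {
  filt_sigma : forall s : R, 0 <= s -> sigma_algebra setT (F s) ;
  filt_sub : forall s : R, 0 <= s -> F s `<=` measurable ;
  filt_nondecreasing : forall s t : R, 0 <= s -> s <= t -> F s `<=` F t ;
  filt_complete : forall A, measurable A -> P A = 0%E -> F 0 A ;
  filt_right_continuous : forall s : R, 0 <= s ->
    \bigcap_(t in [set t | s < t]) F t = F s }.

(* The last clause says that [W t - W s] is independent of [F s] with law
   N(0, (t - s) I); the second parameter of [normal_prob] is the standard
   deviation. *)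
Record brownian_motion F (p : nat) (W : R -> T -> 'cV[R]_p) : Prop :=
  BrownianMotion {
  bm_adapted : forall t : R, 0 <= t -> vec_measurable_wrt (F t) (W t) ;
  bm_continuous : forall w, {within `[0, +oo[, continuous (fun t => W t w)} ;
  bm_start : \forall w \ae P, W 0 w = 0 ;
  bm_increments : forall s t : R, 0 <= s -> s < t ->
    forall A, F s A -> forall B : 'I_p -> set R, (forall i, measurable (B i)) ->
    P (A `&` [set w | forall i, B i (W t w i 0 - W s w i 0)]) =
    (P A * \prod_(i < p) normal_prob 0 (Num.sqrt (t - s)) (B i))%E }.

(* The simple process
   sum_(k < sp_size) sp_val k * 1_]sp_time k, sp_time k.+1] *)
Record simple_process := SimpleProcess {
  sp_size : nat ;
  sp_time : nat -> R ;
  sp_val : nat -> T -> R }.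

Definition simple_on F (a b : R) (S : simple_process) : Prop :=
  [/\ sp_time S 0 = a, sp_time S (sp_size S) = b,
      (forall k, (k < sp_size S)%N -> sp_time S k <= sp_time S k.+1),
      (forall k, (k < sp_size S)%N ->
        measurable_wrt (F (sp_time S k)) (sp_val S k))
    & (exists M : R, forall k w, (k < sp_size S)%N -> `|sp_val S k w| <= M)].

Definition sp_eval (S : simple_process) (t : R) (w : T) : R :=
  \sum_(k < sp_size S)
    sp_val S k w * \1_(`]sp_time S k, sp_time S k.+1]%classic) t.

Definition sp_integral (S : simple_process) (B : R -> T -> R) (w : T) : R :=
  \sum_(k < sp_size S) sp_val S k w * (B (sp_time S k.+1) w - B (sp_time S k) w).

Definition cvg0_in_probability (X : nat -> T -> \bar R) : Prop :=
  forall e : R, 0 < e -> P [set w | (e%:E <= X l w)%E] @[l --> \oo] --> 0%E.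

(* [I] is (a version of) the Ito integral of [H] over [a, b] with respect to
   the scalar Brownian motion [B]: the limit in probability of the integrals
   of simple processes that approximate [H] in L^2([a, b]) in probability. *)
Definition is_ito_integral F (B : R -> T -> R) (a b : R) (H : R -> T -> R)
    (I : T -> R) : Prop :=
  measurable_fun setT I /\
  exists S : nat -> simple_process,
    [/\ (forall l, simple_on F a b (S l)),
        cvg0_in_probability
          (fun l w => \int[leb]_(t in `[a, b])
                        (((sp_eval (S l) t w - H t w) ^+ 2)%:E))%E
      & cvg0_in_probability
          (fun l w => (`|sp_integral (S l) B w - I w|%R)%:E)].

End StochasticCalculus.

Section ControlSystems.
Variable R : realType.

Local Notation leb := (@lebesgue_measure R).

(* Measurable, locally essentially bounded curves from [0, oo) to [U] *)
Definition admissible_curves (m : nat) (U : set 'cV[R]_m) :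
    set (R -> 'cV[R]_m) :=
  [set v : R -> 'cV[R]_m | [/\ (forall t : R, 0 <= t -> U (v t)),
               (forall i, measurable_fun (`[0, +oo[ : set R) (fun t => v t i 0))
             & (forall t1 : R, 0 < t1 -> exists M : R,
                  \forall t \ae leb, 0 <= t -> t <= t1 -> `|v t| <= M)]].

Definition zoh_curves (m : nat) (U : set 'cV[R]_m) (tau : R) :
    set (R -> 'cV[R]_m) :=
  [set v | (forall t : R, 0 <= t -> U (v t)) /\
           (forall k : nat, forall s t : R,
              k%:R * tau <= s < k.+1%:R * tau ->
              k%:R * tau <= t < k.+1%:R * tau -> v s = v t)].

(* The values of [cs_f] at inputs outside [cs_inputs] are irrelevant. *)
Record control_system (n m p : nat) := ControlSystem {
  cs_inputs : set 'cV[R]_m ;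
  cs_curves : set (R -> 'cV[R]_m) ;
  cs_f : 'cV[R]_n -> 'cV[R]_m -> 'cV[R]_n ;
  cs_sigma : 'cV[R]_n -> 'M[R]_(n, p) ;
  cs_curves_admissible : cs_curves `<=` admissible_curves cs_inputs ;
  cs_f_continuous :
    {within [set: 'cV[R]_n] `*` cs_inputs,
      continuous (fun z : 'cV[R]_n * 'cV[R]_m => cs_f z.1 z.2)} ;
  cs_f_lipschitz : exists Lx Lu : R, [/\ 0 < Lx, 0 < Lu &
    forall x x' u u', cs_inputs u -> cs_inputs u' ->
      `|cs_f x u - cs_f x' u'| <= Lx * `|x - x'| + Lu * `|u - u'|] ;
  cs_sigma_continuous : continuous cs_sigma ;
  cs_sigma_lipschitz : exists2 Z : R, 0 < Z &
    forall x x', opnorm (cs_sigma x - cs_sigma x') <= Z * `|x - x'| }.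

Section Concrete.
Context (d : measure_display) (T : measurableType d).
Variables (P : probability T R) (n m p : nat).
Variables (F : R -> set (set T)) (W : R -> T -> 'cV[R]_p).
Variable Sigma : control_system n m p.

(* [xi] solves d xi = f(xi, v) dt + sigma(xi) dW on [s, oo); the clock of the
   input curve [v] starts at the initial time [s]. *)
Definition solution_process (s : R) (v : R -> 'cV[R]_m)
    (xi : R -> T -> 'cV[R]_n) : Prop :=
  [/\ (forall t, s <= t -> vec_measurable_wrt (F t) (xi t)),
      (forall w, {within `[s, +oo[, continuous (fun t => xi t w)})
    & (forall t, s <= t -> exists I : T -> 'M[R]_(n, p),
        (forall i j, is_ito_integral P F (fun r w => W r w j 0) s t
           (fun r w => cs_sigma Sigma (xi r w) i j) (fun w => I w i j)) /\
        \forall w \ae P, forall i,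
          leb.-integrable `[s, t]
            (fun r => (cs_f Sigma (xi r w) (v (r - s)) i 0)%:E) /\
          xi t w i 0 = xi s w i 0
            + \int[leb]_(r in `[s, t]) (cs_f Sigma (xi r w) (v (r - s)) i 0)
            + \sum_(j < p) I w i j)].

Definition sampled_trans (tau : R) (x : random_vector R T n)
    (v : set_type (zoh_curves (cs_inputs Sigma) tau))
    (x' : random_vector R T n) : Prop :=
  exists k : nat,
    [/\ vec_measurable_wrt (F (k%:R * tau)) x,
        vec_measurable_wrt (F (k.+1%:R * tau)) x'
      & exists xi, [/\ solution_process (k%:R * tau) (val v) xi,
          (\forall w \ae P, xi (k%:R * tau) w = x w)
        & (\forall w \ae P, xi (k%:R * tau + tau) w = x' w)]].

Definition sampled_system (tau : R) : system (random_vector R T n) :=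
  @System (random_vector R T n)
    (random_vector R T n) [set x | exists c, forall w, x w = c]
    (set_type (zoh_curves (cs_inputs Sigma) tau))
    (sampled_trans (tau := tau)) id.

End Concrete.

(* A box is given by its pair of opposite corners. *)
Definition box_corners (m : nat) := ('cV[R]_m * 'cV[R]_m)%type.

Definition proper_box (m : nat) (B : box_corners m) : Prop :=
  forall i, B.1 i 0 < B.2 i 0.

Definition box (m : nat) (B : box_corners m) : set 'cV[R]_m :=
  [set b | forall i, B.1 i 0 <= b i 0 <= B.2 i 0].

Definition grid (m : nat) (mu : R) : set 'cV[R]_m :=
  [set b | forall i, exists k : int, b i 0 = k%:~R * mu].

Definition box_union (m : nat) (A : seq (box_corners m)) : set 'cV[R]_m :=
  \bigcup_(B in [set` A]) box B.

Definition quantized_union (m : nat) (mu : R) (A : seq (box_corners m)) :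
    set 'cV[R]_m :=
  \bigcup_(B in [set` A]) (box B `&` @grid m mu).

Section Abstraction.
Context (d : measure_display) (T : measurableType d).
Variables (n m p : nat) (Sigma : control_system n m p).

Definition ode_solution (x : 'cV[R]_n) (u : 'cV[R]_m) (y : R -> 'cV[R]_n) :
    Prop :=
  [/\ y 0 = x, {within `[0, +oo[, continuous y}
    & forall t : R, 0 < t -> is_derive t 1 y (cs_f Sigma (y t) u)].

Definition quantized_trans (tau eta mu : R) (A : seq (box_corners m))
    (x : set_type (@grid n eta)) (u : set_type (quantized_union mu A))
    (x' : set_type (@grid n eta)) : Prop :=
  exists2 y, ode_solution (val x) (val u) y & `|y tau - val x'| <= eta.

(* [A] is the decomposition of the input set of [Sigma] into boxes. *)
Definition quantized_system (tau eta mu : R) (A : seq (box_corners m)) :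
    system (random_vector R T n) :=
  @System (random_vector R T n)
    (set_type (@grid n eta)) setT
    (set_type (quantized_union mu A))
    (@quantized_trans tau eta mu A)
    (fun x => cst_rv T (val x)).

End Abstraction.

End ControlSystems.

(* Main.v *)
Require Import Defs.
From mathcomp Require Import all_boot all_order all_algebra.
From mathcomp Require Import all_classical all_reals all_analysis.
From mathcomp Require Import measurable_realfun.

Set Implicit Arguments.
Unset Strict Implicit.
Unset Printing Implicit Defensive.

Import Order.TTheory GRing.Theory Num.Theory.
Import numFieldNormedType.Exports.

Local Open Scope classical_set_scope.
Local Open Scope ring_scope.

(** The given bisimulation relation itself serves as witness: only the condition on outputs changes.
    Let [p] be the probability that related outputs are at least [eps] apart. Markov's inequality
    for the [q]-th moment, together with [p <= 1 <= q], bounds [eps * p] by the distance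
    ([markov_rv_dist]), hence by [eps * epshat], and cancelling [eps] gives [p <= epshat]. If the
    precision [eps * epshat] is zero, related outputs agree almost surely and [p = 0]
    ([prob_ae_eq_dist]). *)

(** Random vectors are measurable coordinatewise, and the infinity norm is a finite maximum of
    absolute values of coordinates; hence the induction on the index list. *)
Lemma measurable_norm_rvB (R : realType) (d : measure_display)
    (T : measurableType d) (n : nat) (y y' : random_vector R T n) :
  measurable_fun setT (fun w => `|y w - y' w|).
Proof.
under eq_fun do rewrite [`|_|]mx_normrE.
elim: (index_enum _) => [|[i j] s IH].
  by under eq_fun do rewrite big_nil; exact: measurable_cst.
under eq_fun do rewrite big_cons; apply: measurable_maxr => //.
apply: measurableT_comp => //=; rewrite (ord1 j).
under eq_fun do rewrite !mxE.
by apply: measurable_funB; exact: rv_measurable.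
Qed.

Lemma measurable_rv_dist_ge (R : realType) (d : measure_display)
    (T : measurableType d) (n : nat) (y y' : random_vector R T n) (eps : R) :
  measurable [set w | eps <= `|y w - y' w|].
Proof.
rewrite -[X in measurable X]setTI.
by apply: measurable_fun_le => //; exact: measurable_norm_rvB.
Qed.

Lemma le_powR_inv (R : realType) (x q : R) :
  0 <= x <= 1 -> 1 <= q -> x <= x `^ q^-1.
Proof.
move=> /andP[x0 x1] q1; have q0 : 0 < q by exact: lt_le_trans q1.
(* Antitonicity of powers in the exponent requires a positive base, so [x = 0] is split off. *)
move: x0; rewrite le_eqVlt => /predU1P[<-|x0]; first exact: powR_ge0.
rewrite -{1}(powRr1 (ltW x0)) ger_powR ?x0// invf_le1//.
Qed.

Section RandomVectorDistance.
Context (R : realType) (d : measure_display) (T : measurableType d).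
Variables (P : probability T R) (n : nat).
Implicit Types y : random_vector R T n.

(* Markov's inequality for the [q]-th power bounds [eps * p `^ q^-1], where [p]
   is the probability below; since [p <= 1 <= q], this dominates [eps * p]. *)
Lemma markov_rv_dist (q eps : R) y y' : 1 <= q -> 0 < eps ->
  (eps%:E * P [set w | (eps <= `|y w - y' w|)%R] <= rv_dist P q y y')%E.
Proof.
move=> q1 eps0; have q0 : 0 < q by exact: lt_le_trans q1.
set A := [set w | _].
pose N := fun w => `|y w - y' w|.
have mN : measurable_fun setT N by exact: measurable_norm_rvB.
pose X : {RV P >-> R} := mfun_Sub (mem_set mN).
have mA : measurable A by exact: measurable_rv_dist_ge.
have markovX : ((eps `^ q)%:E * P A <= 'E_P[fun w => (N w `^ q)%R])%E.
  have := @markov _ _ _ P X (@powR R ^~ q) eps eps0 (measurable_powR q)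
    (fun r _ => powR_ge0 r q) (ge0_ler_powR (ltW q0)).
  (* [markov] speaks of the absolute value of [X], which is [X] itself, being a norm. *)
  rewrite (_ : [set x | _] = A); last first.
    by apply/seteqP; split=> w; rewrite /A /= lee_fin normr_id.
  congr (_ <= 'E_P[_])%E; apply/funext => w /=.
  by rewrite normr_id.
have PA_fin : P A \is a fin_num by rewrite fin_num_measure.
have PA1 : 0 <= fine (P A) <= 1.
  by rewrite fine_ge0//= -lee_fin fineK// probability_le1.
have PAE : P A = (fine (P A))%:E by rewrite fineK.
have PAq : (P A <= P A `^ q^-1)%E.
  by rewrite PAE poweR_EFin lee_fin; exact: le_powR_inv PA1 q1.
apply: (@le_trans _ _ (eps%:E * P A `^ q^-1)%E).
  by rewrite lee_pmul2l.
(* Moving [eps] under the root turns the goal into the [q]-th root of [markovX]. *)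
have -> : (eps%:E * P A `^ q^-1 = ((eps `^ q)%:E * P A) `^ q^-1)%E.
  rewrite poweRM ?lee_fin ?powR_ge0// poweR_EFin -powRrM divff ?gt_eqF//.
  by rewrite powRr1 ?ltW.
have E0 : (0 <= 'E_P[fun w => (N w `^ q)%R])%E.
  by apply: expectation_ge0 => w; exact: powR_ge0.
apply: gt0_ler_poweR => //; rewrite ?in_itv/= ?leey ?andbT//.
  by rewrite invr_ge0 ltW.
by rewrite mule_ge0// lee_fin powR_ge0.
Qed.

Lemma prob_rv_dist_le (q eps epshat : R) y y' :
    1 <= q -> 0 < eps -> (rv_dist P q y y' <= (eps * epshat)%:E)%E ->
  (P [set w | (eps <= `|y w - y' w|)%R] <= epshat%:E)%E.
Proof.
move=> q1 eps0 dle; rewrite -(@lee_pmul2l _ eps%:E)//.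
by rewrite -EFinM (le_trans _ dle)// markov_rv_dist.
Qed.

Lemma prob_ae_eq_dist (eps : R) y y' : 0 < eps ->
  (\forall w \ae P, y w = y' w) ->
  P [set w | (eps <= `|y w - y' w|)%R] = 0%E.
Proof.
move=> eps0 yy'; apply: measure_negligible.
  exact: measurable_rv_dist_ge.
apply: negligibleS yy' => w /= + yw; rewrite yw subrr normr0.
by rewrite leNgt eps0.
Qed.

(** Stated for arbitrary systems so that it applies to a relation and to its inverse alike. *)
Lemma approx_prob_simulation (q eps epshat : R)
    (Sa Sb : system (random_vector R T n)) (Rel : state Sa -> state Sb -> Prop) :
    1 <= q -> 0 < eps -> 0 <= epshat ->
  @approx_simulation R (rv_space P n q) (eps * epshat) Sa Sb Rel ->
  prob_simulation P eps epshat Rel.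
Proof.
move=> q1 eps0 epshat0 [Hinit Hout Htrans]; split=> // xa xb.
(* At precision zero the output condition yields almost sure equality; otherwise it bounds the
   distance. *)
case: ifPn Hout => _ Hout Rab.
  by rewrite prob_ae_eq_dist ?lee_fin//; apply/Hout.
by apply: prob_rv_dist_le q1 eps0 _; exact: Hout.
Qed.

End RandomVectorDistance.

Theorem theorem5p12 (R : realType) (d : measure_display) (T : measurableType d)
    (P : probability T R)
    (n m p : nat)
    (F : R -> set (set T)) (hF : usual_filtration P F)
    (W : R -> T -> 'cV[R]_p) (hW : brownian_motion P F W)
    (Sigma : control_system R n m p)
    (A : seq (box_corners R m)) (hA : forall B, B \in A -> proper_box B)
    (hU : cs_inputs Sigma = box_union A)
    (tau eta mu : R) (htau : 0 < tau) (heta : 0 < eta) (hmu : 0 < mu)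
    (hcurves : cs_curves Sigma = zoh_curves (cs_inputs Sigma) tau)
    (q : R) (hq : 1 <= q)
    (eps epshat : R) (heps : 0 < eps) (hepshat : 0 <= epshat <= 1) :
  @approx_bisimilar R (rv_space P n q) (eps * epshat)
    (sampled_system P F W Sigma tau) (quantized_system T Sigma tau eta mu A) ->
  prob_bisimilar P eps epshat
    (sampled_system P F W Sigma tau) (quantized_system T Sigma tau eta mu A).
Proof.
case/andP: hepshat => epshat0 _ [Rel [simab simba]].
by exists Rel; split; apply: (approx_prob_simulation hq heps epshat0).
Qed.
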